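(* Let $(L,\vee,\cdot)$ be an algebraic multiplicative lattice in which $m$-distributivity holds. The following conditions are equivalent: (a) $1$ is the unique semiprime element of $L$. (b) For every $x\in L$ with $x\neq 1$, there exists $y\in L$ such that $y>x$ and $y^2\leq x$. (c) There exists a strictly ascending chain $$0=x_0\leq x_1\leq x_2\leq\dots\leq x_\omega\leq x_{\omega+1}\leq\dots\leq x_\alpha=1$$ in $L$, indexed in the ordinal numbers less than or equal to $\alpha$ for some ordinal $\alpha$, such that $x_{\beta+1}^2\leq x_\beta$ for every ordinal $\beta<\alpha$ and $x_\gamma=\bigvee_{\beta<\gamma}x_\beta$ for every limit ordinal $\gamma\leq\alpha$. (d) $L$ has no prime elements, that is, $\mathrm{Spec}(L)=\emptyset$. (e) The semiprime radical of $L$ is $1$. (f) Every $m$-system of $L$ contains $0$.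
   Context: A multiplicative lattice is a complete lattice $(L,\vee,\wedge)$ with least element $0$ and greatest element $1$, equipped with a further binary operation $\cdot\colon L\times L\to L$ satisfying $x\cdot y\leq x\wedge y$ for all $x,y\in L$. No further axioms (associativity, commutativity, identity, monotonicity) are required. Write $xy=x\cdot y$ and $x^2=x\cdot x$. $L$ is algebraic if every element of $L$ is a join of compact elements; $C(L)$ denotes the set of compact elements of $L$. $m$-distributivity holds in $L$ if $(x\vee y)z=xz\vee yz$ and $x(y\vee z)=xy\vee xz$ for all $x,y,z\in L$. An element $p\in L$ is prime if $p\neq 1$ and, for all $x,y\in L$, $xy\leq p$ implies $x\leq p$ or $y\leq p$; $\mathrm{Spec}(L)$ is the set of all prime elements of $L$. An element $s\in L$ is semiprime if, for all $x\in L$, $x^2\leq s$ implies $x\leq s$. The semiprime radical of $L$ is the meet of all prime elements of $L$ (the meet of the empty set being $1$). An $m$-system in $L$ is a nonempty subset $S$ of $C(L)$ such that for all $x,y\in S$ there exists $z\in S$ with $z\leq xy$. *)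

(* Defs.v *)
From HB Require Import structures.
From mathcomp Require Import all_boot all_order.
From mathcomp Require Import boolp classical_sets cardinality.
From mathcomp Require Export wochoice.

Set Implicit Arguments.
Unset Strict Implicit.
Unset Printing Implicit Defensive.

Import Order.TTheory.
Local Open Scope classical_set_scope.
Local Open Scope order_scope.

HB.mixin Record isCompleteLattice d L of Order.TBLattice d L := {
  supremums_neq0 : forall A : set L, supremums A !=set0;
  infimums_neq0 : forall A : set L, infimums A !=set0;
}.

#[short(type="completeLatticeType")]
HB.structure Definition CompleteLattice d :=
  { L of isCompleteLattice d L & Order.TBLattice d L }.

HB.mixin Record isMultiplicative d L of CompleteLattice d L := {
  lmul : L -> L -> L;
  lmul_le_meet : forall x y : L, lmul x y <= x `&` y;
}.

#[short(type="multLatticeType")]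
HB.structure Definition MultLattice d :=
  { L of isMultiplicative d L & CompleteLattice d L }.

Notation "x ** y" := (lmul x y) (at level 40, left associativity) : order_scope.

Section CompleteLatticeTheory.
Context {d : Order.disp_t} {L : completeLatticeType d}.
Implicit Types (A F : set L) (c x : L).

(* [supremum x0] and [infimum x0] return [x0] on the empty set, hence the
   choice of [\bot] and [\top]; on nonempty sets [x0] is irrelevant because
   suprema and infima exist. *)
Definition bigjoin A : L := supremum \bot A.
Definition bigmeet A : L := infimum \top A.

Lemma bigjoinP A : supremums A (bigjoin A).
Proof.
rewrite /bigjoin /supremum; case: ifPn => [/eqP ->|_].
  by split=> [y []|y _]; exact: le0x.
by have [s As] := supremums_neq0 A; apply: xgetI As.
Qed.

Lemma bigmeetP A : infimums A (bigmeet A).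
Proof.
rewrite /bigmeet /infimum; case: ifPn => [/eqP ->|_].
  by split=> [y []|y _]; exact: lex1.
by have [s As] := infimums_neq0 A; apply: xgetI As.
Qed.

Definition compact_elt c : Prop :=
  forall A, c <= bigjoin A ->
    exists F, [/\ finite_set F, F `<=` A & c <= bigjoin F].

End CompleteLatticeTheory.

Definition algebraic d (L : completeLatticeType d) : Prop :=
  forall x : L, exists2 A : set L, A `<=` compact_elt & x = bigjoin A.

Section MultLatticeTheory.
Context {d : Order.disp_t} {L : multLatticeType d}.
Implicit Types (p s x y z : L) (S : set L).

Definition prime_elt p : Prop :=
  p != \top /\ forall x y, x ** y <= p -> x <= p \/ y <= p.

Definition semiprime_elt s : Prop := forall x, x ** x <= s -> x <= s.

Definition m_system S : Prop :=
  [/\ S !=set0, S `<=` compact_elt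
    & forall x y, S x -> S y -> exists2 z, S z & z <= x ** y].

End MultLatticeTheory.

Definition m_distributive d (L : multLatticeType d) : Prop :=
  (forall x y z : L, (x `|` y) ** z = (x ** z) `|` (y ** z)) /\
  (forall x y z : L, x ** (y `|` z) = (x ** y) `|` (x ** z)).

Definition Spec d (L : multLatticeType d) : set L := [set p | prime_elt p].
Arguments Spec {d} L.

Definition semiprime_radical d (L : multLatticeType d) : L := bigmeet (Spec L).

(* The set of ordinals less than or equal to alpha is represented, up to order
   isomorphism, by a well-ordered type with a greatest element: 0 is [\bot] and
   alpha is [\top].  Every well-order with a greatest element is of this form
   for a unique alpha, and alpha = 0 is the case [\bot = \top]. *)
Section OrdinalIndices.
Context {d : Order.disp_t} {W : tbOrderType d}.
Implicit Types b c g : W.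

Definition is_succ b c : Prop := b < c /\ forall g, b < g -> c <= g.

Definition is_limit g : Prop := g != \bot /\ ~ exists b, is_succ b g.

End OrdinalIndices.

Definition has_square_chain d (L : multLatticeType d) : Prop :=
  exists (dW : Order.disp_t) (W : tbOrderType dW) (x : W -> L),
    well_order (<=%O : rel W) /\
    [/\ {homo x : b c / b < c},
        x \bot = \bot,
        x \top = \top,
        forall b c : W, is_succ b c -> x c ** x c <= x b
      & forall g : W, is_limit g -> x g = bigjoin [set x b | b in [set b | b < g]]].

(* Main.v *)
Require Import Defs.
From mathcomp Require Import all_boot all_order.
From mathcomp Require Import boolp classical_sets cardinality.
From HB Require Import structures.

(** Condition (b) says that above every [x < 1] there is some [y > x] that is
    squared into [x].  Iterating such a choice transfinitely, and taking joins
    at limits, climbs from [0] to [1]: this is (c).  Conversely a prime element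
    that lies above [x_b] lies above any [x_c] whose square is below [x_b], and
    it survives joins, so it would lie above every term of such a chain, hence
    above [1]; thus (c) implies (d), and (e) is then the convention on the empty
    meet.

    The algebra takes place in three steps.  If [s] is not semiprime, say
    [z ** z <= s] with [z] not below [s], m-distributivity gives
    [(s `|` z) ** (s `|` z) <= s], which is (b) at [s]
    ([semiprime_top_square_ascent]).  If an m-system [S] omits [0], Zorn's lemma
    gives an element [p] maximal among those that bound no element of [S]; it
    is prime by the classical argument, since [s <= p `|` x] and [t <= p `|` y]
    force the element of [S] below [s ** t] to be below [p] whenever
    [x ** y <= p] ([m_system_prime]); so (e) implies (f).  Finally, below a
    compact [c] not under a semiprime [s] one can choose a compact
    [c' <= c ** c] not under [s]; repeating this produces a decreasing sequence
    that is an m-system omitting [0] ([semiprime_m_system]), so (f) implies (a).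

    The transfinite iteration avoids ordinals, in the manner of Bourbaki and
    Witt.  The least subset of [L] closed under an inflationary map and under
    all joins is well-ordered by the order of [L]; in it the successor of an
    element that is not the top is its image under the map and a limit is the
    join of its predecessors.  This subset is itself the index type of the
    chain. *)
Local Open Scope classical_set_scope.
Local Open Scope order_scope.

Set Implicit Arguments.
Unset Strict Implicit.
Unset Printing Implicit Defensive.
Import Order.TTheory.

(** * Suprema, infima and compact elements *)

Section CompleteLattices.
Context {d : Order.disp_t} {L : completeLatticeType d}.
Implicit Types (A C F : set L) (c x y : L).

Lemma bigjoin_ub A x : A x -> x <= bigjoin A.
Proof. by move=> Ax; have [+ _] := bigjoinP A; apply. Qed.

Lemma bigjoin_le A y : (forall x, A x -> x <= y) -> bigjoin A <= y.
Proof. by move=> leAy; have [_] := bigjoinP A; apply. Qed.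

Lemma bigjoin0 : bigjoin set0 = \bot :> L.
Proof. by apply/eqP; rewrite -lex0; apply: bigjoin_le. Qed.

Lemma bigmeet_lb A x : A x -> bigmeet A <= x.
Proof. by move=> Ax; have [+ _] := bigmeetP A; apply. Qed.

Lemma bigmeet0 : bigmeet set0 = \top :> L.
Proof.
by apply/eqP; rewrite -le1x; have [_] := bigmeetP (set0 : set L); apply.
Qed.

Lemma not_bigjoin_le A y : ~~ (bigjoin A <= y) -> exists2 x, A x & ~~ (x <= y).
Proof.
apply: contraNP => noA; apply: bigjoin_le => x Ax.
by apply: contrapT => /negP Nxy; apply: noA; exists x.
Qed.

Lemma algebraic_compact_nle x y : algebraic L -> ~~ (x <= y) ->
  exists c, [/\ compact_elt c, c <= x & ~~ (c <= y)].
Proof.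
move=> algL; have [A Acompact ->] := algL x => /not_bigjoin_le [c Ac Ncy].
by exists c; split=> //; [apply: Acompact | apply: bigjoin_ub].
Qed.

(** The empty list has no upper bound in [C] when [C] is empty, whence the
    alternative [m = \bot], which is its join. *)
Lemma chain_finite_ub C (s : seq L) :
  {in C &, total <=%O} -> {subset s <= C} ->
  exists2 m, m = \bot \/ C m & {in s, forall x, x <= m}.
Proof.
move=> totC; elim: s => [|x s IHs] sC; first by exists \bot => //; left.
have [y sy|m Cm sm] := IHs; first by apply: sC; rewrite inE sy orbT.
have xC : x \in C by apply: sC; rewrite mem_head.
have [mx|Nmx] := boolP (m <= x).
  exists x; first by right; rewrite inE in xC.
  move=> y; rewrite inE => /predU1P[-> //|/sm ym]; exact: le_trans mx.
exists m => // y; rewrite inE => /predU1P[->|/sm//].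
case: Cm Nmx => [->|Cm]; first by rewrite le0x.
by have := totC x m xC (mem_set Cm); case: (m <= x) => //; rewrite orbF.
Qed.

Lemma compact_le_chain C c :
  compact_elt c -> {in C &, total <=%O} -> c <= bigjoin C ->
  c <= \bot \/ exists2 m, C m & c <= m.
Proof.
move=> cptc totC /cptc[_ [/finite_seqP[s ->] sC cs]].
have [x sx|m Cm sm] := chain_finite_ub (s := s) totC.
  by apply/mem_set/sC.
have cm : c <= m by apply: le_trans cs _; apply: bigjoin_le => x; apply: sm.
by case: Cm cm => [->|Cm]; [left | right; exists m].
Qed.

End CompleteLattices.

(** * Towers: transfinite iteration without ordinals *)

Section Tower.
Context {d : Order.disp_t} {L : completeLatticeType d}.
Variable g : L -> L.
Implicit Types x y z : L.

(** Joining with [x] makes the map inflationary for an arbitrary [g], so that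
    the order instances on the tower below depend on no hypothesis. *)
Definition step x := x `|` g x.

Lemma le_step x : x <= step x.
Proof. exact: leUl. Qed.

(** Joins of empty families are included, so [\bot] is in the tower. *)
Inductive tower : L -> Prop :=
| tower_step x of tower x : tower (step x)
| tower_join (A : set L) of (forall x, A x -> tower x) : tower (bigjoin A).

(** Comparability alone is too weak to go through an induction on the tower; the
    gap between [y] and [step y] is what the inductive argument needs. *)
Definition separating x := forall y, tower y -> x <= y \/ step y <= x.

Lemma separating_step x : separating x ->
  forall y, tower y -> y <= x \/ step x <= y.
Proof.
move=> sepx y; elim=> [{}y Ty [yx|xy]|A TA IHA].
- have [xy|] := sepx _ Ty; last by left.
  by right; have -> : x = y by apply: le_anti; rewrite xy yx.
- by right; apply: le_trans xy (le_step y).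
- have [[z Az xz]|noz] := pselect (exists2 z, A z & step x <= z).
    by right; apply: le_trans xz (bigjoin_ub Az).
  left; apply: bigjoin_le => z Az; have [//|xz] := IHA z Az.
  by case: noz; exists z.
Qed.

Lemma tower_separating x : tower x -> separating x.
Proof.
elim=> [{}x Tx sepx|A TA IHA] y Ty.
- have [yx|] := separating_step sepx Ty; last by left.
  have [xy|yx'] := sepx y Ty; last by right; apply: le_trans yx' (le_step x).
  by right; have -> : x = y by apply: le_anti; rewrite xy yx.
- have [[z Az yz]|noz] := pselect (exists2 z, A z & step y <= z).
    by right; apply: le_trans yz (bigjoin_ub Az).
  left; apply: bigjoin_le => z Az; have [//|yz] := IHA z Az y Ty.
  by case: noz; exists z.
Qed.

Lemma tower_lt_step x y : tower x -> tower y -> x < y -> step x <= y.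
Proof.
move=> Tx Ty xy; have [yx|//] := tower_separating Ty Tx.
by have := lt_le_trans xy yx; rewrite ltxx.
Qed.

Lemma tower_total x y : tower x -> tower y -> (x <= y) || (y <= x).
Proof.
move=> Tx Ty; have [->//|yx] := tower_separating Tx Ty.
by rewrite (le_trans (le_step y) yx) orbT.
Qed.

(** No step leaves the part of the tower below a fixed point of [step], and
    joins do not either. *)
Lemma tower_step_fix m : tower m -> step m <= m ->
  forall y, tower y -> y <= m.
Proof.
move=> Tm stepm y; elim=> [{}y Ty ym|A _ IHA]; last exact: bigjoin_le.
move: ym; rewrite le_eqVlt => /predU1P[->//|]; exact: tower_lt_step.
Qed.

Definition tower_type := {x : L | `[< tower x >]}.
HB.instance Definition _ := SubChoice.on tower_type.
HB.instance Definition _ := [SubChoice_isSubPOrder of tower_type by <: with d].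

Definition Tower x (Tx : tower x) : tower_type := exist _ x (asboolT Tx).

Lemma towerP (b : tower_type) : tower (val b).
Proof. exact/asboolP/(valP b). Qed.

Lemma tower_leE (b c : tower_type) : (b <= c) = (val b <= val c).
Proof. by []. Qed.

Lemma tower_type_total : total (<=%O : rel tower_type).
Proof. by move=> b c; apply: tower_total; apply: towerP. Qed.

HB.instance Definition _ :=
  Order.POrder_isTotal.Build d tower_type tower_type_total.

Definition tower_bot : tower_type :=
  Tower (tower_join (A := set0) (fun x => False_ind _)).

Definition tower_top : tower_type :=
  Tower (tower_join (A := tower) (fun x Tx => Tx)).

Lemma tower_botP b : tower_bot <= b.
Proof. by rewrite tower_leE /= bigjoin0 le0x. Qed.

Lemma tower_topP b : b <= tower_top.
Proof. by rewrite tower_leE; apply/bigjoin_ub/towerP. Qed.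

HB.instance Definition _ := Order.hasBottom.Build d tower_type tower_botP.
HB.instance Definition _ := Order.hasTop.Build d tower_type tower_topP.

(** The candidate minimum of [A] is the join [m] of all tower elements below
    [A].  Were [m] not in [A], then [step m] would also be below [A], so [m]
    would be fixed by [step]; it is then the top of the tower, and so is every
    element of [A]. *)
Lemma tower_well_order : well_order (<=%O : rel tower_type).
Proof.
apply: antisymmetric_well_order => [|A [a Aa]]; first exact: le_anti.
pose lbA := [set x | tower x /\ forall b, b \in A -> x <= val b].
have Tm : tower (bigjoin lbA) by apply: tower_join => x [].
pose m := Tower Tm.
have mA b : b \in A -> m <= b.
  by move=> Ab; rewrite tower_leE; apply: bigjoin_le => x [_]; apply.
have [Am|NAm] := boolP (m \in A); first by exists m.
have step_m : lbA (step (val m)).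
  split=> [|b Ab]; first exact: tower_step.
  apply: (tower_lt_step Tm (towerP b)).
  rewrite -[_ < _]/(m < b) lt_neqAle mA // andbT.
  by apply: contraNneq NAm => ->.
exists a; split=> // b Ab; apply: le_trans _ (mA b Ab).
by rewrite tower_leE; apply: (tower_step_fix Tm (bigjoin_ub step_m) (towerP a)).
Qed.

Lemma tower_succ (b c : tower_type) : is_succ b c -> val c = step (val b).
Proof.
move=> [bc cmin]; have stepc := tower_lt_step (towerP b) (towerP c) bc.
apply/le_anti; rewrite stepc andbT.
apply: (cmin (Tower (tower_step (towerP b)))).
rewrite ltNge; apply/negP => stepb; move: bc; rewrite ltNge => /negP; apply.
by rewrite tower_leE; apply: (tower_step_fix (towerP b) stepb (towerP c)).
Qed.

(** If the join [s] of the predecessors of [l] were smaller than [l], nothing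
    could lie strictly between [s] and [l], and [l] would be the successor
    of [s]. *)
Lemma tower_limit (l : tower_type) : is_limit l ->
  val l = bigjoin [set val b | b in [set b | b < l]].
Proof.
move=> [_ Nsucc]; set s := bigjoin _.
have Ts : tower s by apply: tower_join => _ [b _ <-]; apply: towerP.
have sl : s <= val l by apply: bigjoin_le => _ [b /= /ltW ? <-].
apply: contrapT => Nls; apply: Nsucc; exists (Tower Ts); split.
  rewrite lt_neqAle tower_leE /= sl andbT; apply/eqP => sEl.
  by apply: Nls; rewrite -sEl.
move=> b sb; rewrite leNgt; apply/negP => bl.
have : b <= Tower Ts by rewrite tower_leE; apply: bigjoin_ub; exists b.
by rewrite leNgt sb.
Qed.

End Tower.

(** * Multiplication *)

Section MultLattices.
Context {d : Order.disp_t} {L : multLatticeType d}.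
Implicit Types (p s x y z : L) (S : set L).

Lemma lmul_lel x y : x ** y <= x.
Proof. by have := lmul_le_meet x y; rewrite lexI => /andP[]. Qed.

Lemma lmul_ler x y : x ** y <= y.
Proof. by have := lmul_le_meet x y; rewrite lexI => /andP[]. Qed.

Hypothesis distL : m_distributive L.

Lemma lmul_le2 x y x' y' : x <= x' -> y <= y' -> x ** y <= x' ** y'.
Proof.
have [distl distr] := distL => /join_idPr <- /join_idPr <-.
by rewrite distl !distr -joinA leUl.
Qed.

(** Expanding by distributivity, the three terms other than [x ** y] have [p] as
    a factor. *)
Lemma lmul_join_le p x y : x ** y <= p -> (p `|` x) ** (p `|` y) <= p.
Proof.
have [distl distr] := distL => xyp.
by rewrite distl !distr !leUx !lmul_lel lmul_ler xyp.
Qed.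

Lemma semiprime_top_square_ascent :
  [set s : L | semiprime_elt s] = [set \top] ->
  forall x : L, x != \top -> exists2 y : L, x < y & y ** y <= x.
Proof.
move=> semi1 x x_neq1.
have : ~ semiprime_elt x.
  move=> semix; case/negP: x_neq1; apply/eqP.
  by rewrite -[_ = _]/([set \top] x) -semi1.
move=> /existsNP[z /not_implyP[zzx /negP Nzx]]; exists (x `|` z).
  by rewrite lt_neqAle leUl andbT; apply: contraNneq Nzx => ->; apply: leUr.
exact: lmul_join_le.
Qed.

(** The index type is the tower of a choice function for the ascent, and the
    chain is its inclusion in [L]. *)
Lemma square_ascent_chain :
  (forall x : L, x != \top -> exists2 y : L, x < y & y ** y <= x) ->
  has_square_chain L.
Proof.
move=> ascent; pose g x := xget x [set y | x < y /\ y ** y <= x].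
have gP x : x != \top -> x < g x /\ g x ** g x <= x.
  by move=> /ascent[y xy yyx]; rewrite /g; case: xgetP => [? _ //|/(_ y)[]].
have step_g x : x != \top -> step g x = g x.
  by move=> /gP[/ltW xg _]; apply/join_idPr.
exists d, (tower_type g), val; split; first exact: tower_well_order.
split.
- by [].
- exact: bigjoin0.
- apply: contrapT => /eqP top_neq1; have [+ _] := gP _ top_neq1.
  rewrite -step_g // => /lt_geF/negP; apply.
  by apply/bigjoin_ub/tower_step/towerP.
- move=> b c bc; rewrite (tower_succ bc).
  have b_neq1 : val b != \top.
    apply/eqP => b1; have [+ _] := bc; rewrite ltNge => /negP; apply.
    by rewrite tower_leE b1 lex1.
  by rewrite step_g //; have [] := gP _ b_neq1.
- exact: tower_limit.
Qed.

(** Look at the first term of the chain that is not below the prime [p]. *)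
Lemma chain_no_prime : has_square_chain L -> Spec L = set0.
Proof.
move=> [dW [W [x [woW [_ x0 x1 xsucc xlim]]]]].
apply/seteqP; split=> // p [/negP p_neq1 pP]; apply: p_neq1; rewrite -le1x -x1.
apply/negP => /negP N1p.
have [|b [[Nbp bmin] _]] := woW [pred b | ~~ (x b <= p)]; first by exists \top.
have belowP c : c < b -> x c <= p.
  by move=> cb; apply: contraLR cb => Ncp; rewrite -leNgt; apply: bmin.
case/negP: Nbp; have [[c cb]|Nsucc] := pselect (exists c, is_succ c b).
  have [] := pP (x b) (x b) => //; apply: le_trans (xsucc c b cb) _.
  by apply: belowP; have [] := cb.
have [->|b_neq0] := eqVneq b \bot; first by rewrite x0 le0x.
by rewrite xlim; last by []; apply: bigjoin_le => _ [c /= cb <-]; apply: belowP.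
Qed.

(** Compactness of the elements of [S] makes the family of elements bounding no
    element of [S] closed under joins of chains; it is nonempty because [S]
    omits [\bot], and every maximal member of it is prime. *)
Lemma m_system_prime S : m_system S -> ~ S \bot -> exists p, prime_elt p.
Proof.
move=> [[s0 Ss0] cptS mulS] NS0.
pose avoids := [pred x : L | `[< forall s, S s -> ~~ (s <= x) >]].
have [//|x y z _ _ _|C subC woC|p /asboolP pS pmax] :=
    Zorn's_lemma (R := <=%O : rel L) (S := avoids).
- exact: le_trans.
- exists (bigjoin [set` C]).
    apply/asboolP => s Ss; apply/negP => /(compact_le_chain (cptS s Ss)) [].
    + by move=> x y; rewrite !inE; apply: wo_chainW woC x y.
    + by rewrite lex0 => /eqP s0E; rewrite s0E in Ss.
    + by move=> [m /subC/asboolP/(_ s Ss)/negP].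
  by move=> x Cx; apply: bigjoin_ub.
have above x : ~~ (x <= p) -> exists2 s, S s & s <= p `|` x.
  move=> Nxp; apply: contrapT => noS; case/negP: Nxp.
  apply: le_trans (leUr _ _) (pmax (p `|` x) _ (leUl _ _)).
  by apply/asboolP => s Ss; apply/negP => sx; apply: noS; exists s.
exists p; split=> [|x y xyp].
  by apply/eqP => p1; have := pS _ Ss0; rewrite p1 lex1.
apply: contrapT => /not_orP[/negP/above[s Ss sx] /negP/above[t St ty]].
have [z Sz zst] := mulS s t Ss St; case/negP: (pS z Sz).
by apply: le_trans zst (le_trans (lmul_le2 sx ty) _); apply: lmul_join_le.
Qed.

(** A semiprime [s] gives back only a statement on squares, yet an m-system must
    handle products of distinct elements.  Keeping the sequence decreasing
    bridges the gap: the product of [u m] and [u n] is above the square of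
    whichever of the two comes later. *)
Lemma semiprime_m_system s : algebraic L -> semiprime_elt s -> s != \top ->
  exists2 S : set L, m_system S & ~ S \bot.
Proof.
move=> algL semis s_neq1.
pose Q c := compact_elt c /\ ~~ (c <= s).
have next c : Q c -> exists c', Q c' /\ c' <= c ** c.
  move=> [_ Ncs].
  have [|c' [? ? ?]] := algebraic_compact_nle (x := c ** c) (y := s) algL.
    by apply: contraNN Ncs; apply: semis.
  by exists c'.
have [|c0 [cpt0 _ Nc0s]] := algebraic_compact_nle (x := \top) (y := s) algL.
  by rewrite le1x.
pose u n := iter n (fun c => xget c [set c' | Q c' /\ c' <= c ** c]) c0.
have uP n : Q (u n) /\ u n.+1 <= u n ** u n.
  suff Qu k : Q (u k).
    split=> //; have [c' c'P] := next _ (Qu n).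
    by rewrite /u iterS; case: xgetP => [? _ []|/(_ c')].
  elim: k => // k /[dup] Qk /next[c' c'P].
  by rewrite /u iterS; case: xgetP => [? _ []|/(_ c')].
have u_decr : {homo u : m n / (m <= n)%N >-> n <= m}.
  apply: homo_leq (fun x => le_refl x) _ _ => [y x z xy yz|n].
    exact: le_trans yz xy.
  by have [_ un] := uP n; apply: le_trans un (lmul_lel _ _).
exists (range u); last first.
  by move=> [n _ u0]; have [[_ /negP]] := uP n; rewrite u0 le0x.
split=> [|_ [n _ <-]|_ _ [m _ <-] [n _ <-]].
- by exists c0, 0%N.
- by have [[]] := uP n.
exists (u (maxn m n).+1); first by exists (maxn m n).+1.
have [_ umax] := uP (maxn m n); apply: le_trans umax _.
by apply: lmul_le2; apply: u_decr; rewrite ?leq_maxl ?leq_maxr.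
Qed.

End MultLattices.

Theorem theorem4p11 (d : Order.disp_t) (L : multLatticeType d)
    (algL : algebraic L) (distL : m_distributive L) :
  [<-> [set s : L | semiprime_elt s] = [set \top];
       forall x : L, x != \top -> exists2 y : L, x < y & y ** y <= x;
       has_square_chain L;
       Spec L = set0;
       semiprime_radical L = \top;
       forall S : set L, m_system S -> S \bot].
Proof.
tfae.
- exact: semiprime_top_square_ascent.
- exact: square_ascent_chain.
- exact: chain_no_prime.
- by move=> noprime; rewrite /semiprime_radical noprime bigmeet0.
- move=> radical1 S mS; apply: contrapT => NS0.
  have [p primep] := m_system_prime distL mS NS0.
  have [/negP p_neq1 _] := primep; apply: p_neq1.
  by rewrite -le1x -radical1; apply: bigmeet_lb.
- move=> mS0; apply/seteqP; split=> [s semis|_ -> x _]; last exact: lex1.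
  apply: contrapT => /eqP s_neq1.
  have [S mS NS0] := semiprime_m_system distL algL semis s_neq1.
  by apply: NS0; apply: mS0.
Qed.
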